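(* Let $(M,g,J)$ be a connected Kähler surface which is a QCH manifold with respect to the $J$-invariant $2$-dimensional distribution $\mathcal{D}$, and let $a,b,c\in C^\infty(M)$ be the functions such that $R=a\Pi+b\Phi+c\Psi$. Then $(M,g,J)$ is also a QCH manifold with respect to the distribution $\mathcal{E}=\mathcal{D}^{\perp}$, and if $\Phi',\Psi'$ denote the tensors constructed in the same way as $\Phi,\Psi$ but with $\mathcal{E}$ in place of $\mathcal{D}$, then $$R=(a+b+c)\Pi-(b+2c)\Phi'+c\Psi'.$$
   Context: A Kähler surface is a Kähler manifold $(M,g,J)$ of real dimension $4$. The curvature tensor is $R(X,Y)Z=([\nabla_X,\nabla_Y]-\nabla_{[X,Y]})Z$, $R(X,Y,Z,W)=g(R(X,Y)Z,W)$. A connected Kähler surface $(M,g,J)$ is a QCH manifold (quasi-constant holomorphic sectional curvature) with respect to a global smooth $J$-invariant $2$-dimensional distribution $\mathcal{D}\subset TM$ if, for every $x\in M$ and every unit vector $X\in T_xM$, the holomorphic sectional curvature $R(X,JX,JX,X)$ depends only on $x$ and on $|X_{\mathcal{D}}|=\sqrt{g(X_{\mathcal{D}},X_{\mathcal{D}})}$, where $X_{\mathcal{D}}$ is the orthogonal projection of $X$ on $\mathcal{D}$. In this case there are functions $a,b,c\in C^\infty(M)$ with $R(X,JX,JX,X)=a(x)+b(x)|X_{\mathcal{D}}|^2+c(x)|X_{\mathcal{D}}|^4$ for unit $X\in T_xM$, and $R=a\Pi+b\Phi+c\Psi$, where, with $p_{\mathcal{D}}$ the orthogonal projection onto $\mathcal{D}$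 and $h=g(p_{\mathcal{D}}\cdot,p_{\mathcal{D}}\cdot)$, $$\Pi(X,Y,Z,U)=\tfrac14\big(g(Y,Z)g(X,U)-g(X,Z)g(Y,U)+g(JY,Z)g(JX,U)-g(JX,Z)g(JY,U)-2g(JX,Y)g(JZ,U)\big),$$ $$\Phi(X,Y,Z,U)=\tfrac18\big(g(Y,Z)h(X,U)-g(X,Z)h(Y,U)+g(X,U)h(Y,Z)-g(Y,U)h(X,Z)+g(JY,Z)h(JX,U)-g(JX,Z)h(JY,U)+g(JX,U)h(JY,Z)-g(JY,U)h(JX,Z)-2g(JX,Y)h(JZ,U)-2g(JZ,U)h(JX,Y)\big),$$ $$\Psi(X,Y,Z,U)=-h(JX,Y)h(JZ,U).$$ The tensors $\Phi',\Psi'$ are given by the same formulas with $h$ replaced by $m=g(p_{\mathcal{E}}\cdot,p_{\mathcal{E}}\cdot)$, where $p_{\mathcal{E}}$ is the orthogonal projection onto $\mathcal{E}$. *)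

(* Defs.v *)
From mathcomp Require Import all_boot all_order all_algebra.
From mathcomp Require Import all_classical all_reals all_analysis.
Set Implicit Arguments.
Unset Strict Implicit.
Unset Printing Implicit Defensive.
Import Order.TTheory GRing.Theory Num.Theory.
Import numFieldNormedType.Exports.
Local Open Scope classical_set_scope.
Local Open Scope ring_scope.

(* Vectors are row vectors.  An endomorphism with matrix J acts by X *m J, a  *)
(* bilinear form with matrix G is X *m G *m Y^T, and a subspace is the row    *)
(* space of a square matrix, as in mxalgebra.                                 *)

Section SmoothMaps.
Context {R : realType} {n : nat} {V : normedModType R}.

(* C^0 is continuity on U; f is C^(k+1) on U when it is differentiable on U   *)
(* and all its partial derivatives are C^k on U.                              *)
Fixpoint Ck (k : nat) (U : set 'rV[R]_n) (f : 'rV[R]_n -> V) : Prop :=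
  match k with
  | 0 => forall x, U x -> {for x, continuous f}
  | k'.+1 => (forall x, U x -> differentiable f x) /\
             (forall i : 'I_n, Ck k' U (fun x => 'D_(delta_mx 0 i) f x))
  end.

Definition smooth_on (U : set 'rV[R]_n) (f : 'rV[R]_n -> V) : Prop :=
  forall k, Ck k U f.

End SmoothMaps.

(* Only the restrictions of [coord] to [dom] and of [param] to [img] are      *)
(* meaningful: they are mutually inverse homeomorphisms.                      *)
Record chart (R : realType) (n : nat) (T : topologicalType) := Chart {
  dom : set T;
  img : set 'rV[R]_n;
  coord : T -> 'rV[R]_n;
  param : 'rV[R]_n -> T;
  dom_open : open dom;
  img_open : open img;
  coord_img : forall p, dom p -> img (coord p);
  param_dom : forall x, img x -> dom (param x);
  coordK : forall p, dom p -> param (coord p) = p;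
  paramK : forall x, img x -> coord (param x) = x;
  coord_continuous : forall p, dom p -> {for p, continuous coord};
  param_continuous : forall x, img x -> {for x, continuous param}
}.

(* The atlas is an indexed family of charts; it need not be maximal.          *)
Record manifold (R : realType) (n : nat) := Manifold {
  carrier :> topologicalType;
  chart_index : Type;
  atlas : chart_index -> chart R n carrier;
  manifold_hausdorff : hausdorff_space carrier;
  manifold_second_countable : @second_countable carrier;
  atlas_cover : forall p : carrier, exists i, dom (atlas i) p;
  atlas_smooth : forall i j,
    smooth_on (img (atlas i) `&` param (atlas i) @^-1` dom (atlas j))
              (coord (atlas j) \o param (atlas i))
}.

Section TensorFields.
Context {R : realType} {n : nat} (M : manifold R n).

(* The components at p of a tangent vector in the charts i and j, if p lies   *)
(* in both domains, are related by v_j = v_i *m transition i j p.             *)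
Definition transition (i j : chart_index M) (p : M) : 'M[R]_n :=
  'J (coord (atlas j) \o param (atlas i)) (coord (atlas i) p).

Definition smooth_function (f : M -> R) : Prop :=
  forall i : chart_index M, smooth_on (img (atlas i)) (f \o param (atlas i)).

(* A field of matrices gives, for each chart i and each point p of its        *)
(* domain, components with respect to the coordinate frame of i; the values   *)
(* at points outside the domain of i are irrelevant.                          *)
Definition matrix_field := chart_index M -> M -> 'M[R]_n.

Definition smooth_field (t : matrix_field) : Prop :=
  forall i, smooth_on (img (atlas i)) (t i \o param (atlas i)).

Definition is_bilinear_field (t : matrix_field) : Prop :=
  smooth_field t /\
  forall i j p, dom (atlas i) p -> dom (atlas j) p ->
    t i p = transition i j p *m t j p *m (transition i j p)^T.

Definition is_endo_field (t : matrix_field) : Prop :=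
  smooth_field t /\
  forall i j p, dom (atlas i) p -> dom (atlas j) p ->
    t i p *m transition i j p = transition i j p *m t j p.

(* Smooth distributions of rank r: around every point there is a smooth local *)
(* frame, given by the rows of F.                                             *)
Definition is_distribution (r : nat) (D : matrix_field) : Prop :=
  [/\ forall i p, dom (atlas i) p -> \rank (D i p) = r,
      forall i j p, dom (atlas i) p -> dom (atlas j) p ->
        forall v : 'rV[R]_n,
          (v <= D i p)%MS = (v *m transition i j p <= D j p)%MS
    & forall i p, dom (atlas i) p ->
        exists (V : set 'rV[R]_n) (F : 'rV[R]_n -> 'M[R]_(r, n)),
        [/\ open V, V (coord (atlas i) p), V `<=` img (atlas i), smooth_on V F
          & forall x, V x -> (F x == D i (param (atlas i) x))%MS]].

End TensorFields.

Definition form {R : realType} {n : nat} (G : 'M[R]_n) (X Y : 'rV[R]_n) : R :=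
  (X *m G *m Y^T) 0 0.

Section LocalRiemannianGeometry.
Context {R : realType} {n : nat}.
Variable G : 'rV[R]_n -> 'M[R]_n.
Implicit Types X Y Z : 'rV[R]_n -> 'rV[R]_n.

Definition dmetric (i j k : 'I_n) (x : 'rV[R]_n) : R :=
  'D_(delta_mx 0 i) (fun y => G y j k) x.

(* Gamma^k_(ij) *)
Definition christoffel (k i j : 'I_n) (x : 'rV[R]_n) : R :=
  2^-1 * \sum_(l < n) invmx (G x) k l *
           (dmetric i j l x + dmetric j i l x - dmetric l i j x).

(* The Levi-Civita connection in coordinates. *)
Definition nabla X Y : 'rV[R]_n -> 'rV[R]_n := fun x =>
  'D_(X x) Y x +
  \row_k \sum_(i < n) \sum_(j < n) christoffel k i j x * X x 0 i * Y x 0 j.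

Definition lie X Y : 'rV[R]_n -> 'rV[R]_n := fun x =>
  'D_(X x) Y x - 'D_(Y x) X x.

Definition curvature X Y Z : 'rV[R]_n -> 'rV[R]_n := fun x =>
  nabla X (nabla Y Z) x - nabla Y (nabla X Z) x - nabla (lie X Y) Z x.

(* R(u,v,w,z) at x; since R is a tensor, u, v, w may be extended to the       *)
(* vector fields having constant components.                                  *)
Definition curvature4 (x u v w z : 'rV[R]_n) : R :=
  form (G x) (curvature (cst u) (cst v) (cst w) x) z.

End LocalRiemannianGeometry.

Section Kahler.
Context {R : realType} {n : nat} {M : manifold R n}.
Implicit Types g J D : matrix_field M.

Definition is_metric g : Prop :=
  is_bilinear_field g /\
  forall i p, dom (atlas i) p ->
    (g i p)^T = g i p /\ (forall X, X != 0 -> 0 < form (g i p) X X).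

Definition is_almost_complex J : Prop :=
  is_endo_field J /\
  forall i p, dom (atlas i) p -> J i p *m J i p = - 1%:M.

Definition is_hermitian g J : Prop :=
  forall i p, dom (atlas i) p ->
    forall X Y, form (g i p) (X *m J i p) (Y *m J i p) = form (g i p) X Y.

Definition local_metric g (i : chart_index M) : 'rV[R]_n -> 'M[R]_n :=
  g i \o param (atlas i).

(* nabla J = 0, i.e. nabla_X (J Y) = J (nabla_X Y) *)
Definition is_parallel g J : Prop :=
  forall (i : chart_index M) (X Y : 'rV[R]_n -> 'rV[R]_n),
    smooth_on (img (atlas i)) X -> smooth_on (img (atlas i)) Y ->
    forall x, img (atlas i) x ->
      nabla (local_metric g i) X (fun y => Y y *m J i (param (atlas i) y)) x =
      nabla (local_metric g i) X Y x *m J i (param (atlas i) x).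

Definition is_kahler g J : Prop :=
  [/\ is_metric g, is_almost_complex J, is_hermitian g J & is_parallel g J].

Definition Riem g (i : chart_index M) (p : M) (X Y Z U : 'rV[R]_n) : R :=
  curvature4 (local_metric g i) (coord (atlas i) p) X Y Z U.

(* The rows of kermx (G *m D^T) span the X such that X *m G *m v^T = 0 for    *)
(* every v in D.                                                              *)
Definition perp g D : matrix_field M := fun i p =>
  kermx (g i p *m (D i p)^T).

Definition oproj g D (i : chart_index M) (p : M) (X : 'rV[R]_n) : 'rV[R]_n :=
  X *m proj_mx (D i p) (perp g D i p).

Definition hform g D (i : chart_index M) (p : M) (X Y : 'rV[R]_n) : R :=
  form (g i p) (oproj g D i p X) (oproj g D i p Y).

Definition is_J_invariant J D : Prop :=
  forall i p, dom (atlas i) p -> stablemx (D i p) (J i p).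

(* The function f below expresses that R(X,JX,JX,X), X a unit vector at p,    *)
(* depends only on p and |X_D|.                                               *)
Definition is_QCH g J D : Prop :=
  [/\ is_distribution 2 D, is_J_invariant J D
    & exists f : M -> R -> R,
        forall i p, dom (atlas i) p ->
        forall X, form (g i p) X X = 1 ->
          Riem g i p X (X *m J i p) (X *m J i p) X =
          f p (Num.sqrt (form (g i p) (oproj g D i p X) (oproj g D i p X)))].

End Kahler.

Section CurvatureTensors.
Context {R : realType} {n : nat}.
Variables (g h : 'rV[R]_n -> 'rV[R]_n -> R) (J : 'rV[R]_n -> 'rV[R]_n).

Definition Pi_form (X Y Z U : 'rV[R]_n) : R :=
  4^-1 * (g Y Z * g X U - g X Z * g Y U
        + g (J Y) Z * g (J X) U - g (J X) Z * g (J Y) U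
        - 2 * g (J X) Y * g (J Z) U).

Definition Phi_form (X Y Z U : 'rV[R]_n) : R :=
  8^-1 * (g Y Z * h X U - g X Z * h Y U
        + g X U * h Y Z - g Y U * h X Z
        + g (J Y) Z * h (J X) U - g (J X) Z * h (J Y) U
        + g (J X) U * h (J Y) Z - g (J Y) U * h (J X) Z
        - 2 * g (J X) Y * h (J Z) U - 2 * g (J Z) U * h (J X) Y).

Definition Psi_form (X Y Z U : 'rV[R]_n) : R :=
  - (h (J X) Y * h (J Z) U).

End CurvatureTensors.

Section CurvatureTensorFields.
Context {R : realType} {n : nat} {M : manifold R n}.
Implicit Types g J D : matrix_field M.

Definition Pi_tensor g J (i : chart_index M) (p : M) : 'rV[R]_n -> 'rV[R]_n ->
    'rV[R]_n -> 'rV[R]_n -> R :=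
  Pi_form (form (g i p)) (mulmxr (J i p)).

Definition Phi_tensor g J D (i : chart_index M) (p : M) : 'rV[R]_n -> 'rV[R]_n ->
    'rV[R]_n -> 'rV[R]_n -> R :=
  Phi_form (form (g i p)) (hform g D i p) (mulmxr (J i p)).

Definition Psi_tensor g J D (i : chart_index M) (p : M) : 'rV[R]_n -> 'rV[R]_n ->
    'rV[R]_n -> 'rV[R]_n -> R :=
  Psi_form (hform g D i p) (mulmxr (J i p)).

End CurvatureTensorFields.

(* Main.v *)
From mathcomp Require Import all_boot all_order all_algebra.
From mathcomp Require Import all_classical all_reals all_analysis.
From mathcomp Require Import ring lra.
Require Import Defs.
Import Order.TTheory GRing.Theory Num.Theory.
Import numFieldNormedType.Exports.
Local Open Scope classical_set_scope.
Local Open Scope ring_scope.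
Set Implicit Arguments.
Unset Strict Implicit.

(** Let h and m be the restrictions of the metric g to D and to its complement
    E, extended by the orthogonal projections.  By Pythagoras m = g - h
    (form_proj_perp).  For a unit vector this reads |X_D|^2 = 1 - |X_E|^2, so a
    function of |X_D| is a function of |X_E|: this is the QCH condition for E.

    For the formula, note that Phi is the polarization of Pi: writing Pi_k for
    the tensor Pi built from a symmetric form k, and Phi_k for Phi built from g
    and k, one has Phi_m = Pi_g - Phi_h and Pi_m = Pi_g - 2 Phi_h + Pi_h
    (Phi_form_compl, Pi_form_compl).  On a J-invariant plane, which has a basis
    e, Je, the tensors Pi_h and Psi_h coincide (Pi_form_plane).  As D and E are
    both such planes, Psi' = Pi - 2 Phi + Psi and Phi' = Pi - Phi; substituting
    these in the right-hand side gives a Pi + b Phi + c Psi.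

    It remains to see that E is a smooth J-invariant distribution of rank 2.
    Its invariance and its compatibility with changes of charts are linear
    algebra (stable_perp, perp_basis_change).  A local frame of E is w, Jw, where
    w is the component in E of a constant vector field that lies in E at the
    given point, rescaled so that w is polynomial in g, J and a frame of D
    (smooth_perp_frame).  That w is smooth follows from the closure of the
    classes C^k under sums, continuous linear maps and continuous bilinear
    maps. *)

(** * Orthogonal complements *)

Section BilinearForm.
Context {R : realType} {n : nat}.
Implicit Types (G : 'M[R]_n) (X Y Z : 'rV[R]_n).

Lemma formDl G X Y Z : form G (X + Y) Z = form G X Z + form G Y Z.
Proof. by rewrite /form !mulmxDl mxE. Qed.

Lemma formDr G X Y Z : form G X (Y + Z) = form G X Y + form G X Z.
Proof. by rewrite /form linearD mulmxDr mxE. Qed.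

Lemma formZl G k X Y : form G (k *: X) Y = k * form G X Y.
Proof. by rewrite /form -!scalemxAl mxE. Qed.

Lemma formZr G k X Y : form G X (k *: Y) = k * form G X Y.
Proof. by rewrite /form linearZ -scalemxAr mxE. Qed.

Lemma formNl G X Y : form G (- X) Y = - form G X Y.
Proof. by rewrite -scaleN1r formZl mulN1r. Qed.

Lemma formNr G X Y : form G X (- Y) = - form G X Y.
Proof. by rewrite -scaleN1r formZr mulN1r. Qed.

Lemma form0l G X : form G 0 X = 0.
Proof. by rewrite /form !mul0mx mxE. Qed.

Lemma form_sym G X Y : G^T = G -> form G X Y = form G Y X.
Proof.
move=> symG; rewrite /form -[in LHS](trmxK (X *m G *m Y^T)) mxE.
by rewrite !trmx_mul trmxK symG mulmxA.
Qed.

Lemma form_scalar G X Y : X *m G *m Y^T = (form G X Y)%:M.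
Proof. exact: mx11_scalar. Qed.

End BilinearForm.

Section OrthogonalComplement.
Context {R : realType} {n : nat}.
Variable G : 'M[R]_n.
Hypothesis symG : G^T = G.
Hypothesis posG : forall X, X != 0 -> 0 < form G X X.
Implicit Types (X Y u v : 'rV[R]_n) (D : 'M[R]_n).

Lemma form_eq0 X : form G X X = 0 -> X = 0.
Proof. by move=> h; apply/eqP; apply: contraT => /posG; rewrite h ltxx. Qed.

(** A row of the kernel of G is orthogonal to itself. *)
Lemma metric_unit : G \in unitmx.
Proof.
rewrite -row_free_unit -kermx_eq0; apply/eqP/row_matrixP => i.
rewrite row0; apply: form_eq0.
by rewrite /form -row_mul mulmx_ker row0 mul0mx mxE.
Qed.

Local Notation "D ^perp" := (kermx (G *m D^T)) (at level 8).

Lemma sub_perpP D v :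
  reflect (forall u, (u <= D)%MS -> form G v u = 0) (v <= D^perp)%MS.
Proof.
apply: (iffP sub_kermxP) => [v0 u /submxP[w ->]|v0].
  by rewrite /form trmx_mul !mulmxA -(mulmxA v) v0 mul0mx mxE.
apply/rowP => j; rewrite [RHS]mxE -[RHS](v0 (row j D)) ?row_sub //.
rewrite /form tr_row mulmxA !mxE; apply: eq_bigr => k _.
by rewrite !mxE.
Qed.

Lemma rank_perp D : \rank (D^perp) = (n - \rank D)%N.
Proof.
rewrite mxrank_ker -mxrank_tr trmx_mul trmxK symG.
by rewrite mxrankMfree // row_free_unit metric_unit.
Qed.

Lemma cap_perp D : (D :&: D^perp)%MS = 0.
Proof.
apply/eqP/rowV0P => v; rewrite sub_capmx => /andP[vD /sub_perpP vE].
exact/form_eq0/vE.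
Qed.

Lemma add_perp D : (1%:M <= D + D^perp)%MS.
Proof.
rewrite sub1mx /row_full mxrank_disjoint_sum ?cap_perp // rank_perp.
by rewrite subnKC // rank_leq_col.
Qed.

Local Notation proj D := (proj_mx D D^perp).

(** proj_mx is computed from the matrices D and D^perp, but its action depends
    only on the decomposition of a vector; this lets it be computed for D^perp,
    whose double complement is known only through the inclusion below. *)
Lemma proj_decomp D u v : (u <= D)%MS -> (v <= D^perp)%MS ->
  (u + v) *m proj D = u.
Proof.
move=> uD vE; rewrite mulmxDl proj_mx_id ?cap_perp //.
by rewrite proj_mx_0 ?cap_perp // addr0.
Qed.

Lemma proj_compl D X : (X - X *m proj D <= D^perp)%MS.
Proof. by apply: proj_mx_compl_sub; rewrite (submx_trans (submx1 _)) ?add_perp. Qed.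

Lemma sub_perp_perp D : (D <= D^perp^perp)%MS.
Proof.
apply/row_subP => i; apply/sub_perpP => u /sub_perpP uE.
by rewrite form_sym // uE // row_sub.
Qed.

Lemma proj_perp D X : X *m proj (D^perp) = X - X *m proj D.
Proof.
rewrite -{1}(subrK (X *m proj D) X) proj_decomp ?proj_compl //.
exact: submx_trans (proj_mx_sub _ _ _) (sub_perp_perp D).
Qed.

Lemma form_proj_compl D X Y : form G (X *m proj D) (Y - Y *m proj D) = 0.
Proof.
by rewrite form_sym //; apply: (sub_perpP D _ (proj_compl D Y)); exact: proj_mx_sub.
Qed.

(** By Pythagoras, the restricted metrics of D and of its complement add up to
    the metric: m = g - h. *)
Lemma form_proj_perp D X Y :
  form G (X *m proj (D^perp)) (Y *m proj (D^perp)) =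
  form G X Y - form G (X *m proj D) (Y *m proj D).
Proof.
rewrite (proj_perp D X) (proj_perp D Y).
have := form_proj_compl D X Y; have := form_proj_compl D Y X.
move: (X *m _) (Y *m _) => PX PY; rewrite !(formDl, formDr, formNl, formNr).
rewrite (form_sym PY X) // (form_sym PY PX) //; lra.
Qed.

End OrthogonalComplement.

(** * Planes invariant under a Hermitian complex structure *)

Section HermitianPlane.
Context {R : realType} {n : nat}.
Variables G J : 'M[R]_n.
Hypothesis symG : G^T = G.
Hypothesis posG : forall X, X != 0 -> 0 < form G X X.
Hypothesis J2 : J *m J = - 1%:M.
Hypothesis hermJ : forall X Y, form G (X *m J) (Y *m J) = form G X Y.
Implicit Types (X Y Z U u v e : 'rV[R]_n) (D : 'M[R]_n).

Local Notation "D ^perp" := (kermx (G *m D^T)) (at level 8).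
Local Notation proj D := (proj_mx D D^perp).

Lemma mulJJ X : X *m J *m J = - X.
Proof. by rewrite -mulmxA J2 mulmxN mulmx1. Qed.

Lemma formJl X Y : form G (X *m J) Y = - form G X (Y *m J).
Proof. by rewrite -[LHS]hermJ mulJJ formNl. Qed.

(** A vector is orthogonal to its image because G composed with J is
    skew-symmetric. *)
Lemma formJ0 X : form G X (X *m J) = 0.
Proof. by have := formJl X X; rewrite form_sym //; lra. Qed.

Lemma stable_perp D : stablemx D J -> stablemx (D^perp) J.
Proof.
move=> stD; apply/row_subP => i; rewrite row_mul.
apply/sub_perpP => u uD; rewrite formJl.
have /sub_perpP -> := row_sub i (D^perp); first by rewrite oppr0.
exact: submx_trans (submxMr _ uD) stD.
Qed.

Lemma proj_J D X : stablemx D J -> X *m J *m proj D = X *m proj D *m J.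
Proof.
move=> stD; rewrite -{1}(subrK (X *m proj D) X) addrC mulmxDl proj_decomp //.
- exact: submx_trans (submxMr _ (proj_mx_sub _ _ _)) stD.
- by apply: submx_trans (submxMr _ (proj_compl symG posG _ _)) (stable_perp stD).
Qed.

(** e and e *m J are orthogonal of the same nonzero length, hence independent. *)
Lemma Jplane_span m (D : 'M[R]_(m, n)) e : (D *m J <= D)%MS -> \rank D = 2%N ->
  (e <= D)%MS -> e != 0 -> (col_mx e (e *m J) == D)%MS.
Proof.
move=> stD rD eD e0.
have le : (col_mx e (e *m J) <= D)%MS.
  by rewrite col_mx_sub eD (submx_trans (submxMr _ eD) stD).
rewrite -(mxrank_leqif_eq le) rD eqn_leq rank_leq_row /=.
suff : row_free (col_mx e (e *m J)) by move/eqP => ->.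
rewrite -kermx_eq0; apply/rowV0P => v /sub_kermxP.
rewrite -(hsubmxK v) mul_row_col (mx11_scalar (lsubmx v)) (mx11_scalar (rsubmx v)).
set x := lsubmx v 0 0; set y := rsubmx v 0 0; rewrite !mul_scalar_mx => h.
have s0 : form G e e != 0 by rewrite gt_eqF // posG.
have x0 : x = 0.
  have := form0l G e; rewrite -h formDl !formZl formJl formJ0.
  by rewrite oppr0 mulr0 addr0 => /eqP; rewrite mulf_eq0 (negPf s0) orbF => /eqP.
have y0 : y = 0.
  have := form0l G (e *m J); rewrite -h formDl !formZl hermJ formJ0.
  by rewrite mulr0 add0r => /eqP; rewrite mulf_eq0 (negPf s0) orbF => /eqP.
by rewrite x0 y0 raddf0 row_mx0.
Qed.

(** Pi_h is the Kaehler curvature tensor of constant holomorphic curvature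
    built from h, which is the pullback of the metric of the plane D; on a plane
    there is one algebraic curvature tensor up to scale, so Pi_h and
    Psi_h = - h(JX,Y) h(JZ,U) have to be proportional.  In the coordinates of
    the orthogonal basis e, e *m J the factor is found to be 1. *)
Lemma Pi_form_plane D : stablemx D J -> \rank D = 2%N -> forall X Y Z U,
  let h X Y := form G (X *m proj D) (Y *m proj D) in
  Pi_form h (mulmxr J) X Y Z U = Psi_form h (mulmxr J) X Y Z U.
Proof.
move=> stD rD X Y Z U h.
have [e eD e0] : exists2 e : 'rV_n, (e <= D)%MS & e != 0.
  by apply/rowV0Pn; rewrite -mxrank_eq0 rD.
have coor W : exists x y, W *m proj D = x *: e + y *: (e *m J).
  have : (W *m proj D <= col_mx e (e *m J))%MS.
    by rewrite (eqmxP (Jplane_span stD rD eD e0)) proj_mx_sub.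
  case/submxP => v ->; exists (lsubmx v 0 0), (rsubmx v 0 0).
  by rewrite -{1}(hsubmxK v) mul_row_col -!mul_scalar_mx -!mx11_scalar.
rewrite /Pi_form /Psi_form /h /= !proj_J //.
have [x1 [x2 ->]] := coor X; have [y1 [y2 ->]] := coor Y.
have [z1 [z2 ->]] := coor Z; have [u1 [u2 ->]] := coor U.
rewrite !mulmxDl -!scalemxAl !mulJJ.
rewrite !(formDl, formDr, formZl, formZr, formNl, formNr).
rewrite !formJl !mulJJ !formNr !formJ0; set s := form G e e.
by field.
Qed.

End HermitianPlane.

(** * Algebra of the curvature tensors *)

Section CurvatureAlgebra.
Context {R : realType} {n : nat}.
Variables (g h m : 'rV[R]_n -> 'rV[R]_n -> R) (J : 'rV[R]_n -> 'rV[R]_n).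
Hypothesis mE : forall X Y, m X Y = g X Y - h X Y.

(** Phi_form g h is the polarization of the quadratic expression Pi_form h, so
    Phi_form g is linear in its second argument and Phi_form g g = Pi_form g. *)
Lemma Phi_form_compl X Y Z U :
  Phi_form g m J X Y Z U = Pi_form g J X Y Z U - Phi_form g h J X Y Z U.
Proof. by rewrite /Phi_form /Pi_form !mE; field. Qed.

(** The expansion of the quadratic expression Pi_form at g - h. *)
Lemma Pi_form_compl X Y Z U :
  Pi_form m J X Y Z U =
  Pi_form g J X Y Z U - 2 * Phi_form g h J X Y Z U + Pi_form h J X Y Z U.
Proof. by rewrite /Phi_form /Pi_form !mE; field. Qed.

End CurvatureAlgebra.

(** * Calculus of smooth maps *)

Section SmoothCalculus.
Context {R : realType} {n : nat}.
Implicit Types (U : set 'rV[R]_n) (V W : normedModType R) (k : nat).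

(** The differential of f serves as a first-order expansion of h. *)
Lemma near_eq_differentiable V (f h : 'rV[R]_n -> V) x :
  (\near x, f x = h x) -> differentiable f x -> differentiable h x.
Proof.
move=> fh /diff_locallyP[cf df].
have hE : h \o shift x = cst (h x) + 'd f x +o_ 0 id.
  apply/eqaddoP => e e0.
  have := (eqaddoP _ _ _ _).1 df _ e0.
  have : \forall y \near 0, f (y + x) = h (y + x).
    by move: fh; rewrite (near_shift 0); apply: filterS => y; rewrite /= subr0.
  apply: filterS2 => y; rewrite /= !fctE /= => ->.
  by rewrite (nbhs_singleton fh).
by apply/diff_locallyP; rewrite (diff_unique cf hE).
Qed.

(** The calculus rules below compute a partial derivative only at points of U,
    where the functions are differentiable; the openness of U makes equality on
    U sufficient for comparing the iterated derivatives. *)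
Lemma Ck_ext V k U (f h : 'rV[R]_n -> V) : open U ->
  (forall x, U x -> f x = h x) -> Ck k U f -> Ck k U h.
Proof.
move=> oU; elim: k f h => [|k IH] f h fh Cf.
all: have nfh x (Ux : U x) : \near x, f x = h x
  by apply: filterS fh _; exact: open_nbhs_nbhs.
  move=> x Ux; have := Cf x Ux; rewrite /prop_for /continuous_at (fh x Ux).
  exact: cvg_trans (near_eq_cvg (nfh x Ux)).
case: Cf => fd fp; split=> [x Ux|i].
  exact: near_eq_differentiable (nfh x Ux) (fd x Ux).
by apply: IH (fp i) => x Ux; exact/near_eq_derive/nfh.
Qed.

Lemma CkW V k U (f : 'rV[R]_n -> V) : Ck k.+1 U f -> Ck k U f.
Proof.
elim: k f => [|k IH] f.
  by case=> fd _ x Ux; exact/differentiable_continuous/fd.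
by case=> fd fp; split=> // i; exact: IH.
Qed.

Lemma Ck_subset V k U U' (f : 'rV[R]_n -> V) : U' `<=` U -> Ck k U f -> Ck k U' f.
Proof.
move=> sU; elim: k f => [|k IH] f /=; first by move=> fc x /sU; exact: fc.
by case=> fd fp; split=> [x /sU|i]; [exact: fd | exact/IH/fp].
Qed.

Lemma Ck_cst V k U (v : V) : Ck k U (cst v).
Proof.
elim: k v => [|k IH] v /=; first by move=> x _; exact: cst_continuous.
split=> [x _|i]; first exact: differentiable_cst.
have -> : (fun x : 'rV[R]_n => 'D_(delta_mx 0 i) (cst v) x) = cst (0 : V).
  by rewrite funeqE => x; rewrite derive_cst.
exact: IH.
Qed.

Lemma Ck_add V k U (f h : 'rV[R]_n -> V) : open U ->
  Ck k U f -> Ck k U h -> Ck k U (fun x => f x + h x).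
Proof.
move=> oU; elim: k f h => [|k IH] f h /=.
  by move=> fc hc x Ux; apply: continuousD; [exact: fc | exact: hc].
move=> [fd fp] [hd hp]; split=> [x Ux|i].
  by apply: differentiableD; [exact: fd | exact: hd].
apply: (Ck_ext oU _ (IH _ _ (fp i) (hp i))) => x Ux.
by rewrite -deriveD //; apply: diff_derivable; [exact: fd | exact: hd].
Qed.

Lemma Ck_linear V W k U (L : {linear V -> W}) (f : 'rV[R]_n -> V) : open U ->
  continuous L -> Ck k U f -> Ck k U (fun x => L (f x)).
Proof.
move=> oU cL; elim: k f => [|k IH] f /=.
  by move=> fc x Ux; apply: continuous_comp; [exact: fc | exact: cL].
move=> [fd fp]; split=> [x Ux|i].
  by apply: differentiable_comp; [exact: fd | exact: linear_differentiable].
apply: (Ck_ext oU _ (IH _ (fp i))) => x Ux.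
have dL := linear_differentiable (f x) cL.
rewrite (deriveE _ (fd x Ux)).
rewrite (deriveE (f := L \o f) _ (differentiable_comp (fd x Ux) dL)).
by rewrite (diff_comp (fd x Ux) dL) /= (diff_lin _ cL).
Qed.

(** The Leibniz rule keeps the derivative in the span of terms of the same
    shape, with one factor differentiated and the other one of class C^k. *)
Lemma Ck_bilinear V V' W k U (B : {bilinear V -> V' -> W})
    (f : 'rV[R]_n -> V) (h : 'rV[R]_n -> V') : open U ->
  continuous (fun p : V * V' => B p.1 p.2) -> Ck k U f -> Ck k U h ->
  Ck k U (fun x => B (f x) (h x)).
Proof.
move=> oU cB; elim: k f h => [|k IH] f h /=.
  move=> fc hc x Ux.
  apply: (continuous_comp (f := fun x => (f x, h x)) (g := fun p => B p.1 p.2)).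
    exact: cvg_pair (fc x Ux) (hc x Ux).
  exact: cB.
move=> [fd fp] [hd hp].
have dB p := differentiable_bilin p cB.
have dp x : U x -> differentiable (fun x => (f x, h x)) x.
  by move=> Ux; apply: differentiable_pair; [exact: fd | exact: hd].
split=> [x Ux|i].
  apply: (differentiable_comp (f := fun x => (f x, h x)) (g := fun p => B p.1 p.2)) => //.
  exact: dp.
have fk : Ck k U f by exact: (@CkW _ k).
have hk : Ck k U h by exact: (@CkW _ k).
apply: (Ck_ext oU _ (Ck_add oU (IH _ _ fk (hp i)) (IH _ _ (fp i) hk))) => x Ux.
rewrite (deriveE _ (fd x Ux)) (deriveE _ (hd x Ux)).
rewrite (deriveE (f := (fun p => B p.1 p.2) \o (fun x => (f x, h x))) _
  (differentiable_comp (dp x Ux) (dB _))).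
by rewrite (diff_comp (dp x Ux) (dB _)) /= (diff_bilin _ cB) (diff_pair (fd x Ux) (hd x Ux)).
Qed.

End SmoothCalculus.

Section SmoothMatrices.
Context {R : realType} {n : nat}.
Implicit Types (U : set 'rV[R]_n).

Lemma cvg_mx (T : Type) (F : set_system T) (FF : Filter F) m p
    (f : T -> 'M[R]_(m, p)) (A : 'M[R]_(m, p)) :
  (forall i j, f x i j @[x --> F] --> A i j) -> f x @[x --> F] --> A.
Proof.
move=> fA S [P AP sPS]; rewrite /nbhs /=.
have : \forall x \near F, forall i j, P i j (f x i j).
  apply: filter_forall => i; apply: filter_forall => j; exact: fA (AP i j).
by apply: filterS => x fx; apply: sPS.
Qed.

Lemma continuous_mulmx m p q :
  continuous (fun AB : 'M[R]_(m, p) * 'M[R]_(p, q) => AB.1 *m AB.2).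
Proof.
move=> [A B]; apply: cvg_mx => i j /=; rewrite mxE.
under eq_fun do rewrite mxE.
apply: (cvg_big (op := +%R)) => [|k _]; first exact: add_continuous.
apply: cvgM.
  apply: (cvg_comp _ (fun M : 'M[R]_(m, p) => M i k)); first exact: cvg_fst.
  exact: matrix_normedtype.coord_continuous.
apply: (cvg_comp _ (fun M : 'M[R]_(p, q) => M k j)); first exact: cvg_snd.
exact: matrix_normedtype.coord_continuous.
Qed.

Lemma continuous_trmx m p : continuous (@trmx R m p).
Proof.
move=> A; apply: (cvg_mx (nbhs_filter A)) => i j /=; rewrite mxE.
under eq_fun do rewrite mxE.
exact: matrix_normedtype.coord_continuous.
Qed.

Lemma smooth_mulmx U m p q (f : 'rV[R]_n -> 'M[R]_(m, p))
    (h : 'rV[R]_n -> 'M[R]_(p, q)) : open U ->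
  smooth_on U f -> smooth_on U h -> smooth_on U (fun x => f x *m h x).
Proof.
move=> oU fs hs k.
exact: (Ck_bilinear (B := @mulmx R m p q) oU (@continuous_mulmx _ _ _) (fs k) (hs k)).
Qed.

Lemma smooth_trmx U m p (f : 'rV[R]_n -> 'M[R]_(m, p)) : open U ->
  smooth_on U f -> smooth_on U (fun x => (f x)^T).
Proof. by move=> oU fs k; exact: (Ck_linear oU (@continuous_trmx _ _) (fs k)). Qed.

Lemma smooth_add U m p (f h : 'rV[R]_n -> 'M[R]_(m, p)) : open U ->
  smooth_on U f -> smooth_on U h -> smooth_on U (fun x => f x + h x).
Proof. by move=> oU fs hs k; exact: Ck_add. Qed.

Lemma smooth_cst U m p (A : 'M[R]_(m, p)) : smooth_on U (fun _ => A).
Proof. by move=> k; exact: Ck_cst. Qed.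

Lemma smooth_col_mx U m1 m2 p (f : 'rV[R]_n -> 'M[R]_(m1, p))
    (h : 'rV[R]_n -> 'M[R]_(m2, p)) : open U ->
  smooth_on U f -> smooth_on U h -> smooth_on U (fun x => col_mx (f x) (h x)).
Proof.
move=> oU fs hs.
have -> : (fun x => col_mx (f x) (h x)) =
    (fun x => col_mx 1%:M 0 *m f x + col_mx 0 1%:M *m h x).
  rewrite funeqE => x; rewrite !mul_col_mx !mul1mx !mul0mx add_col_mx.
  by rewrite addr0 add0r.
by apply: (smooth_add oU); apply: smooth_mulmx => //; exact: smooth_cst.
Qed.

End SmoothMatrices.

(** * Smooth frames of the complement *)

Section AdaptedFrame.
Context {R : realType} {n : nat}.
Implicit Types (G J D : 'M[R]_n) (b e X Y : 'rV[R]_n).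

Definition hermitian_pair G J : Prop :=
  [/\ G^T = G, forall X, X != 0 -> 0 < form G X X, J *m J = - 1%:M
    & forall X Y, form G (X *m J) (Y *m J) = form G X Y].

(** form G e e times the component of b orthogonal to the plane of e and e *m J.
    The factor clears the denominators of the projection: the result is a sum of
    matrix products, hence depends smoothly on G, J and e. *)
Definition reject_Jplane G J e b : 'rV[R]_n :=
  (e *m G *m e^T) *m b + ((- b) *m G *m e^T) *m e
  + ((- b) *m G *m (e *m J)^T) *m (e *m J).

Lemma reject_JplaneE G J e b : reject_Jplane G J e b =
  form G e e *: b - form G b e *: e - form G b (e *m J) *: (e *m J).
Proof.
by rewrite /reject_Jplane !form_scalar !mul_scalar_mx !formNl !scaleNr.
Qed.

Lemma reject_Jplane_perp G J D e b : hermitian_pair G J ->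
  stablemx D J -> \rank D = 2%N -> (e <= D)%MS -> e != 0 ->
  (reject_Jplane G J e b <= kermx (G *m D^T))%MS.
Proof.
move=> [symG posG J2 hermJ] stD rD eD e0; apply/sub_perpP => u.
rewrite -(eqmxP (Jplane_span symG posG J2 hermJ stD rD eD e0)) => /submxP[v ->].
rewrite -(hsubmxK v) mul_row_col (mx11_scalar (lsubmx v)) (mx11_scalar (rsubmx v)).
rewrite !mul_scalar_mx reject_JplaneE.
rewrite !(formDl, formDr, formNl, formZl, formZr) hermJ.
rewrite (formJl J2 hermJ e e) (formJ0 symG J2 hermJ); ring.
Qed.

Lemma reject_Jplane_id G J D e b : stablemx D J -> (e <= D)%MS ->
  (b <= kermx (G *m D^T))%MS -> reject_Jplane G J e b = form G e e *: b.
Proof.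
move=> stD eD /sub_perpP bE; rewrite reject_JplaneE !bE ?scale0r ?subr0 //.
exact: submx_trans (submxMr _ eD) stD.
Qed.

End AdaptedFrame.

(** The complement of a J-invariant plane in dimension 4 is a J-invariant plane,
    so a nonvanishing smooth section w of it gives the frame w, w *m J.  Take for
    w the rejection of a fixed vector b that is orthogonal to the plane at x0: it
    does not vanish at x0, hence nowhere on a neighbourhood of x0. *)
Lemma smooth_perp_frame (R : realType) (U : set 'rV[R]_4)
    (G J D : 'rV[R]_4 -> 'M[R]_4) (F : 'rV[R]_4 -> 'M[R]_(2, 4)) (x0 : 'rV[R]_4) :
  open U -> U x0 -> smooth_on U G -> smooth_on U J -> smooth_on U F ->
  (forall x, U x -> hermitian_pair (G x) (J x)) ->
  (forall x, U x -> stablemx (D x) (J x)) ->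
  (forall x, U x -> \rank (D x) = 2%N) ->
  (forall x, U x -> (F x == D x)%MS) ->
  exists (V : set 'rV[R]_4) (E : 'rV[R]_4 -> 'M[R]_(2, 4)),
    [/\ open V, V x0, V `<=` U, smooth_on V E
      & forall x, V x -> (E x == kermx (G x *m (D x)^T))%MS].
Proof.
move=> oU Ux0 Gs Js Fs hGJ stD rD FD.
have rE x : U x -> \rank (kermx (G x *m (D x)^T)) = 2%N.
  by move=> Ux; have [? ? _ _] := hGJ x Ux; rewrite rank_perp // rD.
pose e x : 'rV[R]_4 := delta_mx 0 0 *m F x.
have es : smooth_on U e by apply: smooth_mulmx => //; exact: smooth_cst.
have eD x : U x -> (e x <= D x)%MS.
  by move=> Ux; rewrite -(eqmxP (FD x Ux)) submxMl.
have e0 x : U x -> e x != 0.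
  move=> Ux; rewrite /e -rowE; apply/eqP => r0.
  have /row_freeP[F' FF'] : row_free (F x) by rewrite /row_free (eqmxP (FD x Ux)) rD.
  have := congr1 (row 0) FF'; rewrite row_mul r0 mul0mx => /rowP/(_ 0).
  by rewrite !mxE => /eqP; rewrite eq_sym oner_eq0.
have [b bE b0] : exists2 b : 'rV_4, (b <= kermx (G x0 *m (D x0)^T))%MS & b != 0.
  by apply/rowV0Pn; rewrite -mxrank_eq0 rE.
pose w x := reject_Jplane (G x) (J x) (e x) b.
have mulS := smooth_mulmx oU.
have ws : smooth_on U w.
  apply: (smooth_add oU); first apply: (smooth_add oU).
  - apply: (mulS); last exact: smooth_cst.
    by apply: (mulS); [exact: mulS | exact: smooth_trmx].
  - apply: (mulS) => //; apply: (mulS); last exact: smooth_trmx.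
    by apply: (mulS) => //; exact: smooth_cst.
  - apply: (mulS); last exact: mulS.
    apply: (mulS); last by apply: smooth_trmx => //; exact: mulS.
    by apply: (mulS) => //; exact: smooth_cst.
pose V := U `&` [set x | w x != 0].
have oV : open V.
  rewrite openE => x [Ux wx]; have wc : {for x, continuous w} := ws 0%N x Ux.
  apply: filterI; first exact: open_nbhs_nbhs.
  apply: (wc [set y | y != 0]); apply: open_nbhs_nbhs; split=> //.
  have -> : [set y : 'rV[R]_4 | y != 0] = ~` [set 0].
    by apply/seteqP; split=> y /eqP.
  exact/closed_openC/accessible_closed_set1/hausdorff_accessible/norm_hausdorff.
have VU : V `<=` U by move=> x [].
exists V, (fun x => col_mx (w x) (w x *m J x)); split=> //.
- split=> //=; rewrite /w (reject_Jplane_id (D := D x0)) ?stD ?eD //.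
  by have [_ posG _ _] := hGJ x0 Ux0; rewrite scaler_eq0 negb_or gt_eqF ?posG ?e0.
- have wV : smooth_on V w by move=> k; exact: Ck_subset VU (ws k).
  have JV : smooth_on V J by move=> k; exact: Ck_subset VU (Js k).
  by apply: smooth_col_mx => //; exact: smooth_mulmx.
- move=> x [Ux wx]; have [symG posG J2 hermJ] := hGJ x Ux.
  apply: (Jplane_span symG posG J2 hermJ) => //; last 1 first.
  - by apply: reject_Jplane_perp (hGJ x Ux) _ _ _ _; auto.
  - by apply: stable_perp => //; exact: stD.
  - exact: rE.
Qed.

(** T is an isometry from G1 to G2, invertible because G1 is, so the condition on
    D1 and D2 makes it map D1 onto D2; hence it maps the complement of D1 onto
    that of D2. *)
Lemma perp_basis_change (R : realType) n (T G1 G2 D1 D2 : 'M[R]_n) :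
  G1 = T *m G2 *m T^T -> G1 \in unitmx ->
  (forall v : 'rV[R]_n, (v <= D1)%MS = (v *m T <= D2)%MS) ->
  forall v : 'rV[R]_n,
    (v <= kermx (G1 *m D1^T))%MS = (v *m T <= kermx (G2 *m D2^T))%MS.
Proof.
move=> G1E uG1 DT v.
have uT : T \in unitmx by move: uG1; rewrite G1E !unitmx_mul => /andP[/andP[]].
apply/sub_perpP/sub_perpP => vE u uD.
  have : (u *m invmx T <= D1)%MS by rewrite DT mulmxKV.
  by move=> /vE; rewrite /form G1E -!mulmxA -trmx_mul mulmxKV.
have := uD; rewrite DT => /vE.
by rewrite /form G1E trmx_mul !mulmxA.
Qed.

(** * Complements on a Kaehler surface *)

Section KahlerFields.
Context {R : realType} {n : nat} {M : manifold R n}.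
Variables g J D : matrix_field M.
Hypothesis gJ_kahler : is_kahler g J.

Lemma kahler_hermitian_pair i p : dom (atlas i) p -> hermitian_pair (g i p) (J i p).
Proof.
move=> dp; have [[_ gP] [_ J2] gJ _] := gJ_kahler; have [symG posG] := gP i p dp.
by split=> //; [exact: J2 | exact: gJ].
Qed.

Lemma hform_perp i p X Y : dom (atlas i) p ->
  hform g (perp g D) i p X Y = form (g i p) X Y - hform g D i p X Y.
Proof. by move=> /kahler_hermitian_pair[symG posG _ _]; exact: form_proj_perp. Qed.

Lemma perp_J_invariant : is_J_invariant J D -> is_J_invariant J (perp g D).
Proof.
by move=> stD i p dp; have [? ? ? ?] := kahler_hermitian_pair dp; exact/stable_perp/stD.
Qed.

Lemma Phi_tensor_perp i p X Y Z U : dom (atlas i) p ->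
  Phi_tensor g J (perp g D) i p X Y Z U =
  Pi_tensor g J i p X Y Z U - Phi_tensor g J D i p X Y Z U.
Proof. by move=> dp; apply: Phi_form_compl => *; exact: hform_perp. Qed.

(** Both Psi_h and Psi_m are values of the quadratic expression Pi_form, since
    D and its complement are J-invariant planes; the identity is the expansion
    of Pi_m with m = g - h. *)
Lemma Psi_tensor_perp i p X Y Z U : dom (atlas i) p ->
  stablemx (D i p) (J i p) -> \rank (D i p) = 2%N ->
  \rank (perp g D i p) = 2%N ->
  Psi_tensor g J (perp g D) i p X Y Z U =
  Pi_tensor g J i p X Y Z U - 2 * Phi_tensor g J D i p X Y Z U
  + Psi_tensor g J D i p X Y Z U.
Proof.
move=> dp stD rD rE; have [symG posG J2 hermJ] := kahler_hermitian_pair dp.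
have stE := stable_perp J2 hermJ stD.
have PsiE := Pi_form_plane symG posG J2 hermJ stE rE X Y Z U.
have PsiD := Pi_form_plane symG posG J2 hermJ stD rD X Y Z U.
rewrite /Psi_tensor -[LHS]PsiE -[X in _ + X]PsiD.
by apply: Pi_form_compl => *; exact: hform_perp.
Qed.

End KahlerFields.

Lemma perp_distribution (R : realType) (M : manifold R 4) (g J D : matrix_field M) :
  is_kahler g J -> is_distribution 2 D -> is_J_invariant J D ->
  is_distribution 2 (perp g D).
Proof.
move=> K [rD cD frD] stD; have hp := kahler_hermitian_pair K.
have [[[gs gT] _] [[Js _] _] _ _] := K.
split.
- by move=> i p dp; have [? ? _ _] := hp i p dp; rewrite /perp rank_perp ?rD.
- move=> i j p di dj; have [_ posG _ _] := hp i p di.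
  exact: perp_basis_change (gT i j p di dj) (metric_unit posG) (cD i j p di dj).
- move=> i p dp; have [V [F [oV Vp VI Fs FD]]] := frD i p dp.
  have dV x : V x -> dom (atlas i) (param (atlas i) x).
    by move=> /VI; exact: param_dom.
  have sub (t : matrix_field M) : smooth_field t ->
      smooth_on V (t i \o param (atlas i)).
    by move=> ts k; exact: Ck_subset VI (ts i k).
  have [W [E [oW Wp WV Es EE]]] := smooth_perp_frame
    (D := D i \o param (atlas i)) oV Vp (sub g gs) (sub J Js) Fs
    (fun x Vx => hp i _ (dV x Vx)) (fun x Vx => stD i _ (dV x Vx))
    (fun x Vx => rD i _ (dV x Vx)) FD.
  exists W, E; split=> //; exact: subset_trans WV VI.
Qed.

Theorem proposition1 (R : realType) (M : manifold R 4)
    (g J D : matrix_field M) (a b c : M -> R)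
    (M_connected : connected [set: M])
    (gJ_kahler : is_kahler g J)
    (D_QCH : is_QCH g J D)
    (a_smooth : smooth_function a)
    (b_smooth : smooth_function b)
    (c_smooth : smooth_function c)
    (R_eq : forall (i : chart_index M) (p : M), dom (atlas i) p ->
       forall X Y Z U : 'rV[R]_4,
       Riem g i p X Y Z U =
         a p * Pi_tensor g J i p X Y Z U
         + b p * Phi_tensor g J D i p X Y Z U
         + c p * Psi_tensor g J D i p X Y Z U) :
  is_QCH g J (perp g D) /\
  (forall (i : chart_index M) (p : M), dom (atlas i) p ->
     forall X Y Z U : 'rV[R]_4,
     Riem g i p X Y Z U =
       (a p + b p + c p) * Pi_tensor g J i p X Y Z U
       - (b p + 2 * c p) * Phi_tensor g J (perp g D) i p X Y Z U
       + c p * Psi_tensor g J (perp g D) i p X Y Z U).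
Proof.
have [distD stD [f fE]] := D_QCH.
have distE := perp_distribution gJ_kahler distD stD.
have [[rD _ _] [rE _ _]] := (distD, distE).
split; last first.
  move=> i p dp X Y Z U; rewrite R_eq // (Phi_tensor_perp _ gJ_kahler) //.
  rewrite (Psi_tensor_perp gJ_kahler) //; [by ring | exact: stD | exact: rD | exact: rE].
split=> //; first exact: perp_J_invariant.
(* For a unit vector, the square of |X_D| is 1 - |X_E|^2. *)
exists (fun p t => f p (Num.sqrt (1 - t ^+ 2))) => i p dp X X1.
rewrite (fE i p dp X X1) -!/(hform _ _ i p X X); congr (f p (Num.sqrt _)).
rewrite sqr_sqrtr.
  by rewrite (hform_perp _ gJ_kahler) // X1; ring.
have [_ posG _ _] := kahler_hermitian_pair gJ_kahler dp.
rewrite /hform; have [->|/posG/ltW //] := eqVneq (oproj g (perp g D) i p X) 0.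
by rewrite form0l.
Qed.
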